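(* Let $\mathcal{A}$ be a (nonempty) set of positive integers that is both product-free and sum-free, and let $a_0$ be the least element of $\mathcal{A}$. Then $\mathcal{A}$ has upper density at most $\frac12\left(1-\frac1{5a_0}\right)$.
   Context: For sets $\mathcal{A},\mathcal{B}$ of integers, $\mathcal{A}+\mathcal{B}=\{a+b: a\in\mathcal{A}, b\in\mathcal{B}\}$ and $\mathcal{A}\cdot\mathcal{B}=\{ab: a\in\mathcal{A}, b\in\mathcal{B}\}$ (when $\mathcal{A}=\mathcal{B}$ the two elements are allowed to be equal). A set $\mathcal{A}$ is sum-free if $\mathcal{A}\cap(\mathcal{A}+\mathcal{A})=\emptyset$, and product-free if $\mathcal{A}\cap(\mathcal{A}\cdot\mathcal{A})=\emptyset$. The upper density (upper asymptotic density) of a set $\mathcal{A}$ of positive integers is $\limsup_{x\to\infty}\frac1x|\mathcal{A}\cap[1,x]|$. *)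

(* Defs.v *)
From mathcomp Require Import all_boot all_order all_algebra finmap.
From mathcomp Require Import all_classical all_reals all_analysis.
Import Order.TTheory GRing.Theory Num.Theory.
Import numFieldNormedType.Exports.
Set Implicit Arguments.
Unset Strict Implicit.
Unset Printing Implicit Defensive.
Local Open Scope classical_set_scope.
Local Open Scope ring_scope.

Definition sumset (A B : set nat) : set nat :=
  [set (a + b)%N | a in A & b in B].

Definition productset (A B : set nat) : set nat :=
  [set (a * b)%N | a in A & b in B].

Definition sum_free (A : set nat) : Prop := A `&` sumset A A = set0.

Definition product_free (A : set nat) : Prop := A `&` productset A A = set0.

Definition upto (R : realType) (A : set nat) (x : R) : set nat :=
  A `&` [set n | (1 <= n)%N && (n%:R <= x)].

(* [fset_set] is a junk value on infinite sets; this rules that case out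
   in [upper_density]. *)
Lemma finite_upto (R : realType) (A : set nat) (x : R) : finite_set (upto A x).
Proof.
apply: (@sub_finite_set _ _ `I_(Num.truncn x).+1); last exact: finite_II.
move=> n [_ /= /andP[_ nx]].
by rewrite -(ltr_nat R); apply: le_lt_trans nx _; exact: truncnS_gt.
Qed.

Definition upper_density (R : realType) (A : set nat) : \bar R :=
  limf_esup (fun x : R => ((#|` fset_set (upto A x)|)%:R / x)%:E) +oo%R.

Definition is_least (A : set nat) (a0 : nat) : Prop :=
  A a0 /\ (forall a, A a -> (a0 <= a)%N).

(* Main.v *)
Require Import Defs.
From mathcomp Require Import all_boot all_order all_algebra finmap.
From mathcomp Require Import all_classical all_reals all_analysis.
From mathcomp Require Import zify lra ring.
Import Order.TTheory GRing.Theory Num.Theory.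
Local Open Scope classical_set_scope.
Local Open Scope ring_scope.

(** Write A(n) for the number of elements of A in [1, n]. A product-free set
    does not contain 1, so a0 >= 2 and the bound to be proved is at least 9/20.
    Two cases are distinguished by the parities of the elements of A.

    If all elements have the same parity p, choose an injection f that sends A
    into the complement of A inside the class p: x |-> x + a0 when a0 is even
    (A is sum-free), x |-> a0 * x when a0 is odd (A is product-free). With
    q = n - a0, respectively q = n / a0, the sets A in [1, n] and f (A in
    [1, q]) are disjoint, so A(n) + A(q) <= n/2; moreover A(n) - A(q) is at most
    the number (n - q)/2 of integers of parity p in (q, n]. Adding, 4 A(n) + q
    <= 2 n up to a constant ([count_upto_one_parity]), which is stronger than
    the claim since q is at least about n / a0.

    If both parities occur, the upper density is at most 3/7 < 9/20
    ([count_upto_mixed_parity]). Suppose that n is in A and k = A(n) exceeds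
    3n/7 by enough. The positive differences of elements of A in [1, n] avoid
    A, so there are at most n - k of them. Reduce A in [1, n] modulo m = n -
    a0, the difference of its extreme elements, to a set B. Since b - a0 and n
    - b are both positive differences and are opposite modulo m, about k
    residues are counted twice among the positive differences and their
    opposites, and the set S = B - B in Z/m has at most about 2(n - k) - k = 2n
    - 3k elements. The purely group-theoretic fact ([diffset_subr_closed],
    [diffset_double]) is that a difference set that small is a proper subgroup
    and contains every double. In Z/m a proper subgroup containing all doubles
    contains no odd residue, so all elements of A up to n have the parity of a0
    ([parity_of_dense]). When n is not in A, go down to the largest element of
    A below n.

    Both cases give 10 a0 A(n) <= (5 a0 - 1) n + C with C independent of n, and
    the upper density follows. *)

Set Implicit Arguments.
Unset Strict Implicit.
Unset Printing Implicit Defensive.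

(** * Small difference sets in finite abelian groups *)

Section DifferenceSet.
Variables (G : finZmodType) (B : {set G}).

Definition diffset : {set G} := [set x - y | x in B, y in B].

Definition translate (C : {set G}) (t : G) : {set G} := [set c + t | c in C].

Lemma card_setC_add (C : {set G}) : (#|C| + #|~: C|)%N = #|G|.
Proof. exact: cardsC. Qed.

Lemma card_translate (C : {set G}) (t : G) : #|translate C t| = #|C|.
Proof. by rewrite card_imset //; apply: addIr. Qed.

Lemma mem_translate (C : {set G}) (t x : G) :
  (x \in translate C t) = (x - t \in C).
Proof.
apply/imsetP/idP => [[c cC ->]|xC]; first by rewrite addrK.
by exists (x - t) => //; rewrite subrK.
Qed.

Lemma mem_diffset (x y : G) : x \in B -> y \in B -> x - y \in diffset.
Proof. by move=> xB yB; apply/imset2P; exists x y. Qed.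

Lemma diffsetN (x : G) : x \in diffset -> - x \in diffset.
Proof. by case/imset2P=> a b aB bB ->; rewrite opprB mem_diffset. Qed.

Lemma subset_translateC (t : G) :
  t \notin diffset -> translate B t \subset ~: B.
Proof.
move=> tS; apply/fintype.subsetP => x; rewrite mem_translate inE => xtB.
apply: contra tS => xB.
have -> : t = x - (x - t) by rewrite subKr.
exact: mem_diffset.
Qed.

(** The translates of B by t and u both lie in the complement of B, so they
    overlap in at least 2|B| - (|G| - |B|) points; shift the overlap by -u. *)
Lemma card_inter_translate (t u : G) :
    t \notin diffset -> u \notin diffset ->
  (3 * #|B| <= #|B :&: translate B (t - u)%R| + #|G|)%N.
Proof.
move=> /subset_translateC tB /subset_translateC uB.
have -> : #|B :&: translate B (t - u)| =
          #|translate B u :&: translate B t|.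
  rewrite -(card_translate (B :&: _) u); congr #|pred_of_set _|.
  apply/setP => x; rewrite !(inE, mem_translate).
  by rewrite opprB addrA subrK.
have := cardsUI (translate B u) (translate B t).
rewrite !card_translate => UI.
have : (#|translate B u :|: translate B t| <= #|~: B|)%N.
  by apply: subset_leq_card; rewrite finset.subUset uB tB.
by have := card_setC_add B; lia.
Qed.

Hypothesis small_diffset : (2 * #|diffset| < #|G| + #|B|)%N.

(** Let s = b - c and T be the complement of the difference set. The translates
    of T by b and by c avoid B, and they are too large to be disjoint from one
    another as well. *)
Lemma diffset_sub_nondiff (s : G) : s \in diffset ->
  exists t u, [/\ t \notin diffset, u \notin diffset & s = t - u].
Proof.
case/imset2P => b c bB cB ->.
set T := ~: diffset.
have TB (x : G) : x \in B -> translate T x \subset ~: B.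
  move=> xB; apply/fintype.subsetP => y; rewrite mem_translate !inE.
  apply: contra => yB.
  exact: mem_diffset.
have : translate T b :&: translate T c != finset.set0.
  rewrite -card_gt0.
  have := cardsUI (translate T b) (translate T c).
  have : (#|translate T b :|: translate T c| <= #|~: B|)%N.
    by apply: subset_leq_card; rewrite finset.subUset !TB.
  rewrite !card_translate.
  by have := card_setC_add B; have := card_setC_add diffset; rewrite -/T; lia.
case/finset.set0Pn => x; rewrite inE !mem_translate !inE => /andP[xb xc].
by exists (x - c), (x - b); split=> //; rewrite opprB [RHS]addrC addrA subrK.
Qed.

Hypothesis large_set : (2 * #|G| < 5 * #|B|)%N.

Lemma nondiff_sub_diffset (t u : G) :
  t \notin diffset -> u \notin diffset -> t - u \in diffset.
Proof.
move=> tS uS.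
have : B :&: translate B (t - u) != finset.set0.
  by rewrite -card_gt0; have := card_inter_translate tS uS; lia.
case/finset.set0Pn => x; rewrite inE mem_translate => /andP[xB].
by move/(mem_diffset xB); rewrite subKr.
Qed.

(** By the previous lemmas each difference s is so popular that the intersection
    of B and its translate by s fills at least 3|B| - |G| > |B|/2 of B. For two
    differences these subsets of B meet, and a common point x gives
    s - r = (x - r) - (x - s) with x - r and x - s in B. *)
Lemma diffset_subr_closed (s r : G) :
  s \in diffset -> r \in diffset -> s - r \in diffset.
Proof.
move=> /diffset_sub_nondiff[t [u [tS uS sE]]].
move=> /diffset_sub_nondiff[v [w [vS wS rE]]].
have hs := card_inter_translate tS uS; have hr := card_inter_translate vS wS.
rewrite -sE -rE in hs hr.
have : (B :&: translate B s) :&: (B :&: translate B r) != finset.set0.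
  have := cardsUI (B :&: translate B s) (B :&: translate B r).
  have : (#|(B :&: translate B s) :|: (B :&: translate B r)| <= #|B|)%N.
    by apply: subset_leq_card; rewrite finset.subUset !finset.subsetIl.
  by rewrite -card_gt0; lia.
case/finset.set0Pn => x; rewrite !inE !mem_translate.
case/andP=> /andP[_ xs] /andP[_ xr].
have := mem_diffset xr xs.
by rewrite opprB addrC addrA subrK.
Qed.

(** Write x + x = x - (-x): the difference set and its complement are both
    symmetric, and differences within either one are differences of B. *)
Lemma diffset_double (x : G) : x + x \in diffset.
Proof.
rewrite -[X in X + _]opprK addrC.
have [xS|xS] := boolP (x \in diffset).
  exact: diffset_subr_closed (diffsetN xS).
apply: nondiff_sub_diffset => //; apply: contra xS => /diffsetN.
by rewrite opprK.
Qed.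

End DifferenceSet.

(** * Sum-free sets with many elements *)

(** The range starts at 0, which the sum-free sets considered avoid but the even
    numbers do not. *)
Definition initial (P : pred nat) (n : nat) : {set 'I_n.+1} :=
  [set i : 'I_n.+1 | P i].

Definition count_upto (P : pred nat) (n : nat) : nat := #|initial P n|.

Lemma count_upto_le (P : pred nat) (n : nat) : (count_upto P n <= n.+1)%N.
Proof. by rewrite -[in X in (_ <= X)%N](card_ord n.+1) max_card. Qed.

(** The term 4 a0 + 11 is slack for the boundary effects and for replacing n by
    the modulus n - a0; it also forces the modulus to be at least 2. *)
Lemma parity_of_dense (P : pred nat) (a0 n : nat) :
    (forall a b, P a -> P b -> ~~ P (a + b)%N) ->
    P a0 -> (forall a, P a -> (a0 <= a)%N) -> P n ->
    (3 * n + 4 * a0 + 11 < 7 * count_upto P n)%N ->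
  forall b, P b -> (b <= n)%N -> odd b = odd a0.
Proof.
move=> sumfree Pa0 a0_min Pn dense.
have kn := count_upto_le P n; have a0n := a0_min _ Pn.
set m := (n - a0)%N.
have m1 : (1 < m)%N by rewrite /m; lia.
pose phi (x : nat) : 'Z_m := x%:R.
have phi_m : phi m = 0 by rewrite /phi -Zp_nat_mod // modnn.
have phi_inj x y : (x < m)%N -> (y < m)%N -> phi x = phi y -> x = y.
  by move=> xm ym /(congr1 (@nat_of_ord _)); rewrite !val_Zp_nat // !modn_small.
pose isdiff (d : nat) : bool :=
  `[< (0 < d)%N /\ exists a, [/\ P a, P (d + a)%N & (d + a <= n)%N] >].
pose B : {set 'Z_m} := (fun i : 'I_n.+1 => phi (i - a0)%N) @: initial P n.
pose D : {set 'Z_m} := (fun i : 'I_n.+1 => phi i) @: initial isdiff n.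
pose N : {set 'Z_m} := -%R @: D.
have phiB b : P b -> (b <= n)%N -> phi (b - a0)%N \in B.
  move=> Pb bn; apply/imsetP; exists (inord b); last by rewrite inordK.
  by rewrite inE inordK.
have phiD a b : P a -> P b -> (a < b)%N -> (b <= n)%N -> phi (b - a)%N \in D.
  move=> Pa Pb ab bn; apply/imsetP; exists (inord (b - a)%N).
    rewrite inE inordK; last by lia.
    by apply/asboolP; split; [lia|exists a; rewrite subnK //; lia].
  by rewrite inordK //; lia.
have phiNE a b : (a <= b)%N -> phi (b - a)%N = phi b - phi a.
  by move=> ab; rewrite /phi natrB.
(* Residues modulo m separate all elements except the extreme ones a0 and n,
   which both map to 0: drop n. *)
have cardB : (count_upto P n <= #|B|.+1)%N.
  rewrite /count_upto (cardsD1 ord_max) inE /= Pn add1n ltnS.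
  apply: leq_trans (subset_leq_card (imsetS _ (subD1set _ _))).
  rewrite card_in_imset // => i j; rewrite !inE => /andP[i_n Pi] /andP[j_n Pj].
  have := ltn_ord i; have := ltn_ord j; move: i_n j_n; rewrite -!val_eqE /=.
  move=> i_n j_n jn iln /phi_inj eij; apply: val_inj => /=.
  have := a0_min _ Pi; have := a0_min _ Pj; move: eij; rewrite /m; lia.
(* Sum-freeness: a positive difference of elements of P is not in P. *)
have cardD : (count_upto P n + #|D| <= n.+1)%N.
  apply: (@leq_trans (count_upto P n + #|initial isdiff n|)).
    by rewrite leq_add2l leq_imset_card.
  have := cardsUI (initial P n) (initial isdiff n).
  have -> : initial P n :&: initial isdiff n = finset.set0.
    apply/setP => i; rewrite !inE; apply/negP => /andP[Pi].
    move=> /asboolP[_ [a [Pa Pia _]]].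
    by have := sumfree _ _ Pi Pa; rewrite Pia.
  rewrite cards0 addn0 => <-.
  by rewrite -[in X in (_ <= X)%N](card_ord n.+1) max_card.
have cardN : #|N| = #|D| by rewrite card_imset //; exact: oppr_inj.
(* The residue of b is that of b - a0, and its opposite is that of n - b; both
   are positive differences unless b is extreme. *)
have subDN : B :\ 0 \subset D :&: N.
  apply/fintype.subsetP => x; rewrite !inE => /andP[x0 /imsetP[i]].
  rewrite inE => Pi xE; rewrite {}xE in x0 *.
  have lin : (i <= n)%N by rewrite -ltnS.
  have ia0 : (a0 < i)%N.
    rewrite ltn_neqAle a0_min // andbT; apply: contra x0 => /eqP <-.
    by rewrite subnn.
  have ni : (i < n)%N.
    rewrite ltn_neqAle lin andbT; apply: contra x0 => /eqP ->.
    by rewrite phi_m.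
  rewrite phiD //=; apply/imsetP; exists (phi (n - i)%N); first exact: phiD.
  rewrite !phiNE //; last exact: ltnW.
  move: phi_m; rewrite /m phiNE // => /eqP; rewrite subr_eq0 => /eqP ->.
  by rewrite opprB.
have subS : diffset B \subset 0 |: (D :|: N).
  apply/fintype.subsetP => x /imset2P[y z /imsetP[i + ->] /imsetP[j + ->] ->].
  rewrite !inE => Pi Pj.
  have lin : (i <= n)%N by rewrite -ltnS.
  have ljn : (j <= n)%N by rewrite -ltnS.
  rewrite !phiNE ?a0_min // opprB addrA subrK.
  case: (ltngtP i j) => [ij|ji|->]; last by rewrite subrr eqxx.
  - apply/orP; right; apply/orP; right; apply/imsetP.
    by exists (phi (j - i)%N); [exact: phiD|rewrite phiNE ?opprB // ltnW].
  - by rewrite -phiNE ?(ltnW ji) // phiD ?orbT.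
have cardG : #|{: 'Z_m}| = m by rewrite card_ord Zp_cast.
have cardS : (#|diffset B| + #|B| <= 2 + 2 * #|D|)%N.
  have := leq_add (subset_leq_card subS) (subset_leq_card subDN).
  have := cardsUI D N; rewrite cardN cardsU1 (cardsD1 0 B).
  have := leq_b1 (0 \in B); have := leq_b1 (0 \notin D :|: N).
  move: (nat_of_bool _) (nat_of_bool _) #|B :\ 0| #|D :|: N| #|D :&: N|.
  by move: #|D| #|diffset B|; lia.
have small : (2 * #|diffset B| < #|{: 'Z_m}| + #|B|)%N.
  by rewrite cardG; move: cardB cardD cardS; rewrite /m; lia.
have large : (2 * #|{: 'Z_m}| < 5 * #|B|)%N.
  by rewrite cardG; move: cardB; rewrite /m; lia.
have subr_closed := diffset_subr_closed small large.
have double := diffset_double small large.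
move=> b Pb bn; apply: contraTeq isT => odd_b; exfalso.
have phi0B : phi 0%N \in B by rewrite -(subnn a0) phiB.
have S0 : 0 \in diffset B by rewrite -(subrr (phi 0%N)); exact: mem_diffset.
(* An odd residue in the subgroup differs from 1 by a double, so the subgroup
   would be the whole group. *)
have S1 : phi 1%N \in diffset B.
  have := mem_diffset (phiB _ Pb bn) phi0B; rewrite subr0.
  move=> /subr_closed /(_ (double (phi (b - a0)./2))).
  suff -> : phi (b - a0)%N - (phi (b - a0)./2 + phi (b - a0)./2) = phi 1%N.
    by [].
  rewrite /phi -natrD addnn.
  have {1}-> : (b - a0 = (b - a0)./2.*2 + 1)%N.
    rewrite -[LHS]odd_double_half oddB ?a0_min // addnC.
    by move: odd_b; case: (odd b); case: (odd a0).
  by rewrite natrD addrC addKr.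
have SE j : phi j \in diffset B.
  elim: j => [//|j IH]; have := subr_closed _ _ IH (diffsetN S1).
  by rewrite opprK /phi -natrD addn1.
have SG : #|{: 'Z_m}| = #|diffset B|.
  by apply/esym/eq_card => x; rewrite -(natr_Zp x) SE.
have BG : (#|B| <= #|diffset B|)%N by rewrite -SG; exact: max_card.
by move: small; rewrite SG; move: #|B| #|diffset B| BG; lia.
Qed.

(** * Counting one residue class modulo 2 *)

Lemma count_uptoS (P : pred nat) (n : nat) :
  count_upto P n.+1 = (count_upto P n + P n.+1)%N.
Proof.
have countE q : count_upto P q = (\sum_(i < q.+1) P i)%N.
  rewrite /count_upto /initial -sum1dep_card big_mkcond.
  by apply: eq_bigr => i _; case: (P i).
by rewrite !countE big_ord_recr.
Qed.

Lemma count_upto0 (P : pred nat) : count_upto P 0 = P 0%N.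
Proof.
rewrite /count_upto /initial -sum1dep_card big_mkcond big_ord1.
by case: (P 0%N).
Qed.

Lemma count_upto_parity (p : bool) (n : nat) :
  (n <= 2 * count_upto (fun x => odd x == p) n <= n + 2)%N.
Proof.
have -> : count_upto (fun x => odd x == p) n =
          (n./2 + (if odd n then 1 else ~~ p))%N.
  elim: n => [|n IH]; first by rewrite count_upto0; case: p.
  rewrite count_uptoS IH -uphalfE uphalf_half /=.
  by case: (odd n); case: p {IH}; rewrite /=; lia.
have := odd_double_half n; rewrite -muln2.
by case: (odd n); case: p => /=; lia.
Qed.

Lemma count_upto_disjoint_image (P Q : pred nat) (f : nat -> nat) (q n : nat) :
    injective f -> (forall x, (x <= q)%N -> (f x <= n)%N) ->
    (forall x, P x -> Q x) -> (forall x, P x -> Q (f x)) ->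
    (forall x, P x -> ~~ P (f x)) ->
  (count_upto P n + count_upto P q <= count_upto Q n)%N.
Proof.
move=> f_inj fqn PQ PQf Pf.
pose F (i : 'I_q.+1) : 'I_n.+1 := inord (f i).
have FE i : F i = f i :> nat by rewrite inordK // ltnS fqn // -ltnS.
have F_inj : injective F.
  by move=> i j /(congr1 val); rewrite /= !FE => /f_inj /val_inj.
have := cardsUI (initial P n) (F @: initial P q).
rewrite [#|F @: _|]card_imset //.
have -> : initial P n :&: (F @: initial P q) = finset.set0.
  apply/setP => x; rewrite !inE; apply/negP => /andP[Px /imsetP[i]].
  by rewrite inE => /Pf Pfi xE; move: Px; rewrite xE FE; apply/negP.
rewrite cards0 addn0 /count_upto => <-.
apply: subset_leq_card; apply/fintype.subsetP => x; rewrite !inE.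
case/orP => [/PQ//|/imsetP[i]]; rewrite inE => /PQf Qfi ->.
by rewrite FE.
Qed.

Lemma count_upto_increment (P Q : pred nat) (q n : nat) :
    (forall x, P x -> Q x) -> (q <= n)%N ->
  (count_upto P n + count_upto Q q <= count_upto P q + count_upto Q n)%N.
Proof.
move=> PQ /subnKC <-; elim: (n - q)%N => [|d IH]; first by rewrite addn0.
rewrite addnS !count_uptoS.
have : (P (q + d).+1 <= Q (q + d).+1)%N.
  by case Px: (P _); rewrite // PQ.
by lia.
Qed.

(** Bound A(n) + A(q) by disjointness of P and its image, and A(n) - A(q) by
    counting all integers of parity p in (q, n], then add: the unknown A(q)
    cancels, which is what gains over the trivial density 1/2. *)
Lemma count_upto_one_parity (P : pred nat) (p : bool) (f : nat -> nat)
    (q n : nat) :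
    injective f -> (q <= n)%N -> (forall x, (x <= q)%N -> (f x <= n)%N) ->
    (forall x, P x -> odd x = p) -> (forall x, P x -> odd (f x) = p) ->
    (forall x, P x -> ~~ P (f x)) ->
  (4 * count_upto P n + q <= 2 * n + 4)%N.
Proof.
move=> f_inj qn fqn Pp Pfp Pf.
pose Q x := odd x == p.
have inQ x : P x -> Q x by move=> /Pp /eqP.
have inQf x : P x -> Q (f x) by move=> /Pfp /eqP.
have h1 := count_upto_disjoint_image f_inj fqn inQ inQf Pf.
have [h2 h3] := (andP (count_upto_parity p n), andP (count_upto_parity p q)).
have h4 := count_upto_increment inQ qn.
by rewrite -/Q in h2 h3; lia.
Qed.

(** At an element n of P above b the bound is the contrapositive of
    [parity_of_dense]; it persists until the next element because the count does
    not change while n grows. *)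
Lemma count_upto_mixed_parity (P : pred nat) (a0 b n : nat) :
    (forall a c, P a -> P c -> ~~ P (a + c)%N) ->
    P a0 -> (forall a, P a -> (a0 <= a)%N) ->
    P b -> odd b != odd a0 -> (b <= n)%N ->
  (7 * count_upto P n <= 3 * n + 4 * a0 + 11)%N.
Proof.
move=> sumfree Pa0 a0_min Pb oddb.
have bound k : P k -> (b <= k)%N ->
    (7 * count_upto P k <= 3 * k + 4 * a0 + 11)%N.
  move=> Pk bk; rewrite leqNgt; apply: contra oddb => dense.
  by rewrite (parity_of_dense sumfree Pa0 a0_min Pk dense Pb bk).
elim: n => [|n IH] bn; first by apply: bound => //; move: bn Pb; case: (b).
have [Pn|nPn] := boolP (P n.+1); first exact: bound.
rewrite count_uptoS (negbTE nPn) addn0.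
have /IH : (b <= n)%N.
  rewrite -ltnS ltn_neqAle bn andbT; apply: contra nPn => /eqP <-.
  exact: Pb.
by lia.
Qed.

(** * The linear bound and the upper density *)

Lemma count_upto_linear_bound (P : pred nat) (a0 : nat) :
    (forall a b, P a -> P b -> ~~ P (a + b)%N) ->
    (forall a b, P a -> P b -> ~~ P (a * b)%N) ->
    (0 < a0)%N -> P a0 -> (forall a, P a -> (a0 <= a)%N) ->
  exists C, forall n,
    (10 * a0 * count_upto P n + n <= 5 * a0 * n + C)%N.
Proof.
move=> sumfree prodfree a0_gt0 Pa0 a0_min.
have a0_gt1 : (1 < a0)%N.
  rewrite ltn_neqAle a0_gt0 andbT; apply/eqP => a0E.
  by have := prodfree _ _ Pa0 Pa0; rewrite -a0E muln1 a0E Pa0.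
have [[b [Pb oddb]]|same] := pselect (exists b, P b /\ odd b != odd a0).
  (* The density 3/7 suffices because 5 * a0 >= 7; below b the trivial count
     goes into the constant. *)
  exists (10 * a0 * (b + 4 * a0 + 11) + b)%N => n.
  have [bn|nb] := leqP b n.
    by have := count_upto_mixed_parity sumfree Pa0 a0_min Pb oddb bn; nia.
  by have := count_upto_le P n; nia.
have {}same x : P x -> odd x = odd a0.
  by move=> Px; apply/eqP/negP => /negP oddx; apply: same; exists x.
have [odd_a0|even_a0] := boolP (odd a0).
  exists (13 * a0)%N => n.
  have : (4 * count_upto P n + n %/ a0 <= 2 * n + 4)%N.
    apply: (count_upto_one_parity (p := true) (f := muln a0)).
    - by move=> x y /eqP; rewrite eqn_pmul2l // => /eqP.
    - exact: leq_div.
    - by move=> x xq; rewrite mulnC -leq_divRL.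
    - by move=> x /same ->.
    - by move=> x /same; rewrite oddM odd_a0.
    - by move=> x; apply: prodfree.
  by have := ltn_ceil n a0_gt0; nia.
exists (10 * a0 * (a0 + 4) + a0)%N => n.
have [a0n|na0] := leqP a0 n; last by have := count_upto_le P n; nia.
have : (4 * count_upto P n + (n - a0) <= 2 * n + 4)%N.
  apply: (count_upto_one_parity (p := false) (f := addn a0)).
  - exact: addnI.
  - exact: leq_subr.
  - by move=> x; lia.
  - by move=> x /same; rewrite (negbTE even_a0).
  - by move=> x /same; rewrite oddD (negbTE even_a0).
  - by move=> x; apply: sumfree.
by nia.
Qed.

Lemma card_upto_le (R : realType) (A : set nat) (x : R) : 0 <= x ->
  (#|` fset_set (upto A x)| <=
    count_upto (fun n => `[< A n >]) (Num.truncn x))%N.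
Proof.
move=> x0; set N := Num.truncn x.
have sub : (fset_set (upto A x) `<=`
    [fset nat_of_ord i | i in initial (fun n => `[< A n >]) N])%fset.
  apply/fsubsetP => n; rewrite in_fset_set; last exact: finite_upto.
  rewrite inE => -[An /andP[_ nx]].
  have nN : (n < N.+1)%N by rewrite ltnS /N truncn_ge_nat.
  apply/imfsetP; exists (Ordinal nN) => //=.
  by rewrite inE; apply/asboolP.
apply: leq_trans (fsubset_leq_card sub) _.
rewrite card_imfset; last exact: val_inj.
by rewrite /count_upto cardE.
Qed.

Lemma upper_density_le (R : realType) (A : set nat) (b C : R) :
    (forall x : R, 0 < x -> (#|` fset_set (upto A x)|)%:R <= b * x + C) ->
  (upper_density R A <= b%:E)%E.
Proof.
move=> bound; apply/lee_addgt0Pr => e e0.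
pose M := Num.max 1 (C / e).
rewrite /upper_density /limf_esup.
apply: le_trans (ereal_inf_lbound _) _.
  exists [set x : R | M < x] => //.
  by apply: nbhs_pinfty_gt; apply: num_real.
apply: ge_ereal_sup => _ [x /= Mx <-].
rewrite -EFinD lee_fin.
have x0 : 0 < x by apply: lt_trans Mx; rewrite lt_max ltr01.
have xC : C <= e * x.
  rewrite mulrC -ler_pdivrMr //; apply: ltW; apply: le_lt_trans Mx.
  by rewrite le_max lexx orbT.
rewrite ler_pdivrMr //; apply: le_trans (bound x x0) _.
by rewrite mulrDl lerD2l.
Qed.

Theorem theorem1p1 (R : realType) (A : set nat) (a0 : nat)
    (A_pos : forall a, A a -> (0 < a)%N)
    (A_product_free : product_free A)
    (A_sum_free : sum_free A)
    (a0_least : is_least A a0) :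
  (upper_density R A <= (1 / 2 * (1 - 1 / (5 * a0%:R)))%:E)%E.
Proof.
have [Aa0 a0_min] := a0_least.
have a0_gt0 := A_pos _ Aa0.
pose P n := `[< A n >].
have sumfree a b : P a -> P b -> ~~ P (a + b)%N.
  move=> /asboolP Aa /asboolP Ab; apply/negP => /asboolP Aab.
  suff : (A `&` sumset A A) (a + b)%N by rewrite A_sum_free.
  by split=> //; exists a => //; exists b.
have prodfree a b : P a -> P b -> ~~ P (a * b)%N.
  move=> /asboolP Aa /asboolP Ab; apply/negP => /asboolP Aab.
  suff : (A `&` productset A A) (a * b)%N by rewrite A_product_free.
  by split=> //; exists a => //; exists b.
have Pa0 : P a0 by apply/asboolP.
have P_min a : P a -> (a0 <= a)%N by move=> /asboolP /a0_min.
have [C bound] := count_upto_linear_bound sumfree prodfree a0_gt0 Pa0 P_min.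
pose D : R := 10 * a0%:R.
have a0R : 0 < a0%:R :> R by rewrite ltr0n.
have D0 : 0 < D by rewrite /D; lra.
have a1R : 1 <= a0%:R :> R by rewrite ler1n.
apply: (@upper_density_le _ _ _ (C%:R / D)) => x x0.
have -> : 1 / 2 * (1 - 1 / (5 * a0%:R)) * x + C%:R / D =
          ((5 * a0%:R - 1) * x + C%:R) / D.
  by rewrite /D; field; lra.
rewrite ler_pdivlMr //.
set N := Num.truncn x.
have NX : N%:R <= x by rewrite truncn_le ltW.
have := card_upto_le A (ltW x0); rewrite -(ler_nat R) -/P -/N.
have := bound N; rewrite -(ler_nat R) !natrD !natrM /D.
move: (count_upto P N)%:R => k.
nra.
Qed.
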